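(* For real $\alpha,\nu$ and $x>0$ let $$D_{\alpha}(\nu,x)=\frac{x}{\varphi_{\alpha}(\nu,x)+\sqrt{\varphi_{\alpha}(\nu,x)^2+x^2}},\qquad \varphi_{\alpha}(\nu,x)=\left(\nu-\tfrac12\right)-\frac{\tau}{2\sqrt{\tau^2+x^2}},\qquad \tau=\nu-\tfrac12(\alpha+1).$$ Then for all $\nu\ge 1/2$ and all $x>0$ $$D_{2\nu-1}(\nu,x)\le \frac{K_{\nu-1}(x)}{K_{\nu}(x)}\le D_0(\nu,x),$$ where the equalities only hold for $\nu=1/2$. Moreover, no bound $D_\alpha(\nu,x)$ with fixed $\alpha\neq 0$ ($\alpha$ not depending on $\nu$) exists that is sharper than $D_{2\nu-1}(\nu,x)$ or $D_0(\nu,x)$ for $\nu\ge 1/2$. That is, there is no real $\alpha\ne 0$, independent of $\nu$ and $x$, such that either $D_{2\nu-1}(\nu,x)\le D_\alpha(\nu,x)\le K_{\nu-1}(x)/K_\nu(x)$ for all $\nu\ge1/2$, $x>0$, with the first inequality strict for at least one $(\nu,x)$, or $K_{\nu-1}(x)/K_\nu(x)\le D_\alpha(\nu,x)\le D_0(\nu,x)$ for all $\nu\ge1/2$, $x>0$, with the last inequality strict for at least one $(\nu,x)$.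
   Context: $K_\nu$ denotes the modified Bessel function of the second kind of real order $\nu$. In $D_{2\nu-1}(\nu,x)$ the parameter $\alpha$ is taken equal to $2\nu-1$, so that $\tau=0$ and $\varphi_{2\nu-1}(\nu,x)=\nu-\tfrac12$. *)

(* Defs.v *)
From mathcomp Require Import all_boot all_order all_algebra.
From mathcomp Require Import all_classical all_reals all_analysis.

Set Implicit Arguments.
Unset Strict Implicit.
Unset Printing Implicit Defensive.

Import Order.TTheory GRing.Theory Num.Theory.
Import numFieldNormedType.Exports.

Local Open Scope classical_set_scope.
Local Open Scope ring_scope.

Definition cosh {R : realType} (t : R) : R := (expR t + expR (- t)) / 2.

(* Modified Bessel function of the second kind of real order nu, through its
   integral representation
     K_nu(x) = int_0^{+oo} exp(- x cosh t) cosh(nu t) dt,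
   valid for every real nu (integers included) when 0 < x. The value is only
   meaningful for 0 < x, where the integrand is Lebesgue-integrable. *)
Definition besselK {R : realType} (nu x : R) : R :=
  \int[@lebesgue_measure R]_(t in `[0, +oo[) (expR (- (x * cosh t)) * cosh (nu * t)).

Definition tau {R : realType} (alpha nu : R) : R := nu - (alpha + 1) / 2.

Definition phi {R : realType} (alpha nu x : R) : R :=
  (nu - 1 / 2) - tau alpha nu / (2 * Num.sqrt (tau alpha nu ^+ 2 + x ^+ 2)).

Definition Dbound {R : realType} (alpha nu x : R) : R :=
  x / (phi alpha nu x + Num.sqrt (phi alpha nu x ^+ 2 + x ^+ 2)).

Definition Kratio {R : realType} (nu x : R) : R :=
  besselK (nu - 1) x / besselK nu x.

(* Main.v *)
(* Put h = K_(nu-1) / K_nu and l = nu - 1/2. Differentiation under the integral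
   sign and the recurrence 2 nu K_nu = x (K_(nu+1) - K_(nu-1)) give the Riccati
   equation h' = h^2 + 2 l h / x - 1, and 0 < h <= 1 because cosh is monotone.
   The bound D_alpha is the positive root h of q(x, h) = x h^2 + 2 phi h - x,
   so each inequality is the statement that q(x, h(x)) has a fixed sign.
   Suppose l > 0 and the sign is wrong at one point. A suitable multiple f of
   q(x, h(x)) satisfies "f >= 0 implies f' > 0", so the wrong sign persists,
   with f bounded away from 0; then h' is bounded away from 0, which
   contradicts 0 < h <= 1.
   No other alpha is admissible, because at nu = 1/2 all the quantities of the
   first part equal 1, while D_alpha(1/2, x) = 1 only for alpha = 0. *)

Require Import Defs.
From mathcomp Require Import all_boot all_order all_algebra.
From mathcomp Require Import all_classical all_reals all_analysis.
From mathcomp Require Import measurable_realfun ring lra.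
Import Order.TTheory GRing.Theory Num.Theory.
Import numFieldNormedType.Exports.
Set Implicit Arguments.
Unset Strict Implicit.
Local Open Scope classical_set_scope.
Local Open Scope ring_scope.

(** * Persistence and growth from differential inequalities on a half-line *)

Section ode_comparison.
Context {R : realType}.
Implicit Types (f df : R -> R) (a b x y d M : R).

Lemma is_derive_continuous f df a b :
  (forall x, a <= x -> is_derive x 1 f (df x)) ->
  {within `[a, b], continuous f}.
Proof.
move=> fdf; apply: derivable_within_continuous => x.
by rewrite in_itv/= => /andP[/fdf fx _]; exact: ex_derive.
Qed.

Lemma MVT_ray f df a x y :
  (forall x, a <= x -> is_derive x 1 f (df x)) -> a <= x -> x < y ->
  exists2 c, x < c < y & f y - f x = df c * (y - x).
Proof.
move=> fdf ax xy.
have [z||c cxy ->] := @MVT R f df x y xy.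
- by rewrite in_itv/= => /andP[xz _]; apply: fdf; rewrite (le_trans ax)// ltW.
- by apply: (@is_derive_continuous f df) => z xz; apply: fdf;
  rewrite (le_trans ax).
- by exists c => //; move: cxy; rewrite in_itv.
Qed.

Lemma derive_gt0_right f x d b :
  is_derive x 1 f d -> 0 < d -> x < b -> exists2 y, x < y < b & f x < f y.
Proof.
move=> fx d0 xb.
have fxd : h^-1 *: (f (h + x) - f x) @[h --> 0^'] --> d.
  have := @ex_derive _ _ _ _ _ _ _ fx; rewrite /derivable.
  move=> /cvg_ex[l lP]; have := @derive_val _ _ _ _ _ _ _ fx.
  rewrite /derive => dE; have ld : l = d.
    by rewrite -dE; apply/esym/cvg_lim.
  by move: lP; rewrite ld; under eq_fun do rewrite scaler1.
have : \forall h \near 0^', 0 < h^-1 *: (f (h + x) - f x).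
  exact: (cvgr_gt d).
case=> e /= e0 eP.
pose h := Num.min (e / 2) ((b - x) / 2).
have h0 : 0 < h by rewrite /h lt_min !divr_gt0 ?subr_gt0.
have he : h < e.
  by rewrite (@le_lt_trans _ _ (e / 2)) ?ge_min ?lexx//; lra.
have hb : h < b - x.
  by rewrite (@le_lt_trans _ _ ((b - x) / 2)) ?ge_min ?lexx ?orbT//; lra.
exists (h + x); first by rewrite ltrDr h0 -ltrBrDr.
have := eP h; rewrite /= sub0r normrN gtr0_norm// => /(_ he).
by rewrite gt_eqF// => /(_ isT); rewrite pmulr_rgt0 ?invr_gt0// subr_gt0.
Qed.

(** A maximum point [c] of [f] on [[a, x]] satisfies [f c >= f a >= 0], hence has positive
    derivative. If [c < x], larger values would occur just to its right, so the maximum is attained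
    at [x]. *)
Lemma barrier_ge f df a :
  (forall x, a <= x -> is_derive x 1 f (df x)) ->
  (forall x, a <= x -> 0 <= f x -> 0 < df x) -> 0 <= f a ->
  forall x, a <= x -> f a <= f x.
Proof.
move=> fdf df0 fa x ax.
have [c] := EVT_max ax (@is_derive_continuous f df a x fdf).
rewrite in_itv/= => /andP[ac]; rewrite le_eqVlt => /predU1P[-> cmax|cx cmax].
  by apply: cmax; rewrite in_itv/= lexx.
have fac : f a <= f c by apply: cmax; rewrite in_itv/= lexx.
have [y /andP[cy yx]] := derive_gt0_right (fdf _ ac) (df0 _ ac (le_trans fa
  fac)) cx.
by rewrite ltNge cmax// in_itv/= (le_trans ac) ltW.
Qed.

(** Moving from [a] to [a + 1] turns the weak inequality [0 <= f a] into a positive lower bound that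
    holds uniformly from there on. *)
Lemma barrier f df a :
  (forall x, a <= x -> is_derive x 1 f (df x)) ->
  (forall x, a <= x -> 0 <= f x -> 0 < df x) -> 0 <= f a ->
  forall x, a + 1 <= x -> 0 < f (a + 1) <= f x.
Proof.
move=> fdf df0 fa x ax.
have a1 : a < a + 1 by rewrite ltrDl.
have fa1 : 0 < f (a + 1).
  have [c /andP[ac _]] := MVT_ray fdf (lexx a) a1.
  rewrite addrAC subrr add0r mulr1 => fE.
  have fac := barrier_ge fdf df0 fa (ltW ac).
  by rewrite (le_lt_trans fa)// -subr_gt0 fE df0 ?(le_trans fa fac)// ltW.
have geW z : a + 1 <= z -> a <= z by exact/le_trans/ltW.
rewrite fa1/=; apply: (@barrier_ge f df (a + 1)) => // [z|z|]; last exact: ltW.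
  by move/geW; exact: fdf.
by move/geW; exact: df0.
Qed.

Lemma derive_ge_unbounded f df a d M :
  (forall x, a <= x -> is_derive x 1 f (df x)) -> 0 < d ->
  (forall x, a <= x -> d <= df x) -> exists2 x, a <= x & M < f x.
Proof.
move=> fdf d0 ddf.
(* Chosen so that [d * T = d + |M - f a|], which exceeds [M - f a]. *)
pose T := 1 + `|M - f a| / d.
have T0 : 0 < T by rewrite /T ltr_pwDl// divr_ge0// ltW.
exists (a + T); first by rewrite lerDl ltW.
have aT : a < a + T by rewrite ltrDl.
have [c /andP[ac _]] := MVT_ray fdf (lexx a) aT.
rewrite addrAC subrr add0r => /eqP; rewrite subr_eq => /eqP ->.
rewrite -ltrBlDr (le_lt_trans (ler_norm _))//.
apply: (@lt_le_trans _ _ (d * T)).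
  by rewrite /T mulrDr mulr1 (mulrC d (_ / _)) divfK ?gt_eqF// ltrDr.
by rewrite ler_pM2r// ddf// ltW.
Qed.

End ode_comparison.

(** * Strict bounds for positive solutions of the Riccati equation *)

Section riccati.
Context {R : realType}.
Implicit Types (h : R -> R) (l x : R).

(** The conclusion amounts to [h' > 0]: the bound is the nullcline of the equation. If it fails at
    [a], then [f = - h'] is nonnegative there and satisfies
    [f' = (2 h + 2 l / x) f + 2 l h / x ^ 2], so [f] stays above a positive constant and [h] is
    driven below 0. *)
Lemma riccati_lower h l : 0 < l ->
  (forall x, 0 < x -> is_derive x 1 h (h x ^+ 2 + 2 * l * h x / x - 1)) ->
  (forall x, 0 < x -> 0 < h x) ->
  forall x, 0 < x -> x < x * h x ^+ 2 + 2 * l * h x.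
Proof.
move=> l0 hdh h0 a a0; rewrite ltNge; apply/negP => le_a.
have gt0 x : a <= x -> 0 < x by exact: lt_le_trans.
pose f x := 1 - h x ^+ 2 - 2 * l * h x / x.
pose df x := f x * (2 * h x + 2 * l / x) + 2 * l * h x / x ^+ 2.
have fdf x : a <= x -> is_derive x 1 f (df x).
  move=> /gt0 x0; have hx := hdh _ x0; have xn0 : x != 0 by rewrite gt_eqF.
  have ix := is_deriveV xn0 (is_derive_id x 1).
  rewrite (_ : f = cst 1 - h ^+ 2 - (cst (2 * l) * h) * (fun y => (id y)^-1)).
    apply: is_derive_eq; rewrite ?fctE /df /f /= /GRing.scale/=; field.
    by [].
  by [].
have df0 x : a <= x -> 0 <= f x -> 0 < df x.
  move=> /gt0 x0 fx; have hx := h0 _ x0; rewrite /df ltr_wpDl//.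
    by rewrite mulr_ge0// addr_ge0// ?divr_ge0// ?mulr_ge0// ltW.
  by rewrite divr_gt0 ?exprn_gt0// !mulr_gt0.
have fa : 0 <= f a.
  rewrite /f -(pmulr_rge0 _ a0).
  rewrite (_ : a * (_ - _) = a - (a * h a ^+ 2 + 2 * l * h a)) ?subr_ge0//.
  by field; rewrite gt_eqF.
have fge := barrier fdf df0 fa.
have /andP[d0 _] := fge _ (lexx _).
have a1 x : a + 1 <= x -> 0 < x.
  by move=> ax; apply: gt0; rewrite (le_trans _ ax)// lerDl.
have [|||x ax] := @derive_ge_unbounded R (- h) f (a + 1) (f (a + 1)) 0.
- move=> x /a1 x0; have hx := hdh _ x0.
  by apply: is_derive_eq; rewrite /f; ring.
- by [].
- by move=> x /fge/andP[].
- by rewrite fctE oppr_gt0 ltNge ltW// h0// a1.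
Qed.

(* [(2 * l - l / r) / x] is the coefficient m of f = h ^+ 2 + m h - 1 in
   [riccati_upper], the last summand is its derivative, and c = 2 h + m. *)
Lemma upper_supersolution l x r c : 0 < l -> 0 < x -> 0 < r -> 0 < c ->
  r ^+ 2 = l ^+ 2 + x ^+ 2 ->
  ((2 * l - l / r) / x) ^+ 2 + 4 <= c ^+ 2 ->
  0 < c * (l / r / x) + (l / r ^+ 3 - (2 * l - l / r) / x ^+ 2).
Proof.
move=> l0 x0 r0 c0 r2 c2.
have xn0 : x != 0 by rewrite gt_eqF.
have rn0 : r != 0 by rewrite gt_eqF.
rewrite (_ : c * _ + _ = l / (r * x ^+ 2) * (c * x - (2 * r - 1 - x ^+ 2 / r
  ^+ 2))).
  2: by field; rewrite xn0 ?rn0 ?gt_eqF.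
rewrite pmulr_rgt0 ?divr_gt0 ?mulr_gt0 ?exprn_gt0// subr_gt0.
(* With [k] in []0, 1[], [l ^ 2] and [x ^ 2] become [k r ^ 2] and [(1 - k) r ^ 2], so that only [k]
   and [r] remain. *)
pose k := l ^+ 2 / r ^+ 2.
have lk : l ^+ 2 = k * r ^+ 2 by rewrite /k divfK// expf_neq0.
have xk : x ^+ 2 = (1 - k) * r ^+ 2 by rewrite mulrBl -lk r2; ring.
have k1 : 0 < 1 - k by rewrite -(pmulr_lgt0 _ (exprn_gt0 2 r0)) -xk exprn_gt0.
have k0 : 0 < k by rewrite /k divr_gt0// exprn_gt0.
have AE : 2 * r - 1 - x ^+ 2 / r ^+ 2 = 2 * r - 2 + k.
  by rewrite xk; field.
rewrite AE.
(* If the right-hand side is nonpositive there is nothing to do; otherwise both sides may be squared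
   to use the bound on [c ^ 2]. *)
have [A0|A0] := leP (2 * r - 2 + k) 0;
  first by rewrite (le_lt_trans A0)// mulr_gt0.
rewrite -(ltr_pXn2r (n := 2))// ?nnegrE ?ltW ?mulr_gt0//.
apply: (@lt_le_trans _ _ ((((2 * l - l / r) / x) ^+ 2 + 4) * x ^+ 2));
  last first.
  by rewrite [leRHS]exprMn ler_pM2r// exprn_gt0.
have -> : (((2 * l - l / r) / x) ^+ 2 + 4) * x ^+ 2 =
          l ^+ 2 * (2 - r^-1) ^+ 2 + 4 * x ^+ 2.
  by field; rewrite xn0 ?rn0 ?gt_eqF.
rewrite lk xk -subr_gt0.
(* By [A0], [8 r - 4 + k > 4 - 3 k], which is positive because [k < 1]. *)
rewrite (_ : _ - _ = (1 - k) * (8 * r - 4 + k)); last by field.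
by rewrite mulr_gt0//; lra.
Qed.

(** Here [h' = f + h l / (r x)], where [f = h ^ 2 + m h - 1]. Differentiating [f] leaves a multiple
    of [f] plus a remainder that [upper_supersolution] makes positive. If [f >= 0] at one point,
    then [f], and with it [h'], is eventually bounded below by a positive constant, and [h] passes
    1. *)
Lemma riccati_upper h l : 0 < l ->
  (forall x, 0 < x -> is_derive x 1 h (h x ^+ 2 + 2 * l * h x / x - 1)) ->
  (forall x, 0 < x -> 0 < h x <= 1) ->
  forall x, 0 < x ->
    x * h x ^+ 2 + (2 * l - l / Num.sqrt (l ^+ 2 + x ^+ 2)) * h x < x.
Proof.
move=> l0 hdh h01 a a0; rewrite ltNge; apply/negP => le_a.
have gt0 x : a <= x -> 0 < x by exact: lt_le_trans.
pose r x : R := Num.sqrt (l ^+ 2 + x ^+ 2).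
have s0 x : 0 < l ^+ 2 + x ^+ 2 by rewrite ltr_pwDl ?sqr_ge0 ?exprn_gt0.
have r0 x : 0 < r x by rewrite sqrtr_gt0.
have r2 x : r x ^+ 2 = l ^+ 2 + x ^+ 2 by rewrite sqr_sqrtr// ltW.
pose m x := (2 * l - l / r x) / x.
pose dm x := l / r x ^+ 3 - (2 * l - l / r x) / x ^+ 2.
pose f x := h x ^+ 2 + m x * h x - 1.
pose df x := (2 * h x + m x) * f x +
  h x * ((2 * h x + m x) * (l / r x / x) + dm x).
have mdm x : 0 < x -> is_derive x 1 m (dm x).
  move=> x0; have xn0 : x != 0 by rewrite gt_eqF.
  have rn0 : r x != 0 by rewrite gt_eqF.
  have ix := is_deriveV xn0 (is_derive_id x 1).
  have dr : is_derive x 1 r (x / r x).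
    have dq : is_derive x 1 (cst (l ^+ 2) + id ^+ 2 : R -> R) (2 * x).
      by apply: is_derive_eq; rewrite /GRing.scale/=; ring.
    have := @is_derive1_comp R Num.sqrt (cst (l ^+ 2) + id ^+ 2) x _ _
      (is_derive1_sqrt (s0 x)) dq.
    move=> rr; rewrite (_ : x / r x = (2 * r x)^-1 * (2 * x)) //; last by field.
  have irx := is_deriveV rn0 dr.
  rewrite (_ : m = (cst (2 * l) - cst l * (fun y => (r y)^-1)) * (fun y =>
    (id y)^-1)).
    apply: is_derive_eq; rewrite ?fctE /dm /= /GRing.scale/=; field.
    by rewrite xn0 rn0.
  by [].
have fdf x : a <= x -> is_derive x 1 f (df x).
  move=> /gt0 x0; have hx := hdh _ x0; have mx := mdm _ x0.
  rewrite (_ : f = h ^+ 2 + m * h - cst 1)//.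
  apply: is_derive_eq; rewrite ?fctE /df /f /= /GRing.scale/=.
  have -> : 2 * l * h x / x = m x * h x + l / r x / x * h x.
    by rewrite /m; field; rewrite !gt_eqF.
  ring.
(* From [f >= 0] follows [h (h + m) >= 1], hence [h + m >= 0], although [m] itself may be
   negative. *)
have m0 x : 0 < x -> 0 <= f x -> 0 < 2 * h x + m x.
  move=> x0 fx; have /andP[hx hx1] := h01 _ x0.
  have : 0 <= h x * (h x + m x).
    by move: fx; rewrite /f mulrDr (mulrC (h x) (m x)) -expr2; lra.
  by rewrite pmulr_rge0//; lra.
have df0 x : a <= x -> 0 <= f x -> 0 < df x.
  move=> /gt0 x0 fx; have /andP[hx _] := h01 _ x0; have c0 := m0 _ x0 fx.
  rewrite /df ltr_wpDl// ?mulr_ge0// ?(ltW c0)//.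
  rewrite mulr_gt0//; apply: upper_supersolution => //.
  (* Completing the square gives [(2 h + m) ^ 2 = m ^ 2 + 4 + 4 f]. *)
  rewrite -/(m x); move: fx; rewrite /f; nra.
have fa : 0 <= f a.
  rewrite /f -(pmulr_rge0 _ a0).
  rewrite (_ : a * (_ - _) = a * h a ^+ 2 + (2 * l - l / r a) * h a - a)
    ?subr_ge0//.
  by rewrite /m; field; rewrite !gt_eqF.
have fge := barrier fdf df0 fa.
have /andP[d0 _] := fge _ (lexx _).
have a1 x : a + 1 <= x -> 0 < x.
  by move=> ax; apply: gt0; rewrite (le_trans _ ax)// lerDl.
have [|||x ax] := @derive_ge_unbounded R h
    (fun x => h x ^+ 2 + 2 * l * h x / x - 1) (a + 1) (f (a + 1)) 1.
- by move=> x /a1 /hdh.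
- by [].
- move=> x ax; have /andP[_ /le_trans] := fge _ ax; apply.
  have x0 := a1 _ ax; have /andP[hx _] := h01 _ x0.
  rewrite -subr_ge0 (_ : _ - _ = h x * (l / r x / x)).
    by rewrite mulr_ge0// ?divr_ge0// ltW.
  by rewrite /f /m; field; rewrite !gt_eqF.
- by case/a1/h01/andP: ax => _; rewrite leNgt => /negP.
Qed.

End riccati.

(** * Integration of exponentially decaying functions on the half-line *)

Section exponential_decay.
Context {R : realType}.
Notation mu := (@lebesgue_measure R).
Implicit Types (f F : R -> R) (c t : R).

Lemma is_derive_expRN t : is_derive t 1 (fun u : R =>
  expR (- u)) (- expR (- t)).
Proof.
have := @is_derive1_comp R expR -%R t _ _ (is_derive_expR _) (is_deriveN
  (is_derive_id t 1)).
by rewrite mulrN1.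
Qed.

Lemma continuous_expRN : continuous (fun t : R => expR (- t)).
Proof.
by move=> t; apply: continuous_comp;
  [exact: continuousN|exact: continuous_expR].
Qed.

Lemma integral_expRN : (\int[mu]_(t in `[0%R, +oo[) (expR (- t))%:E = 1%E)%E.
Proof.
rewrite (@ge0_continuous_FTC2y _ _ (fun t : R => - expR (- t)) _ 0).
- by rewrite !oppr0 expR0 EFinN oppeK add0e.
- by move=> t _; exact: expR_ge0.
- by apply: continuous_subspaceT; exact: continuous_expRN.
- by rewrite -[X in _ --> X]oppr0; apply: cvgN; exact: cvgr_expR.
- by move=> t _; apply: ex_derive; apply: is_deriveN; exact: is_derive_expRN.
- by apply: cvgN; apply/cvg_at_right_filter; exact: continuous_expRN.
- move=> t _; rewrite derive1E.
  have /@derive_val := is_deriveN (is_derive_expRN t).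
  by rewrite opprK.
Qed.

Lemma integrable_expRN c :
  mu.-integrable `[0, +oo[ (EFin \o (fun t => c * expR (- t))).
Proof.
rewrite (_ : _ \o _ = fun t => c%:E * (expR (- t))%:E)%E//.
apply: integrableZl => //.
apply/integrableP; split.
  apply/measurable_EFinP/measurable_funTS; apply: continuous_measurable_fun.
  exact: continuous_expRN.
under eq_integral do rewrite /= ger0_norm ?expR_ge0//.
by rewrite integral_expRN ltry.
Qed.

Lemma Rintegral_expRN c : \int[mu]_(t in `[0, +oo[) (c * expR (- t)) = c.
Proof.
rewrite RintegralZl//.
  by rewrite /Rintegral integral_expRN mulr1.
have := integrable_expRN 1; congr (mu.-integrable _ _).
by apply/funext => t /=; rewrite mul1r.
Qed.

Lemma decay_integrable f c : continuous f ->
  (forall t, 0 <= t -> `|f t| <= c * expR (- t)) ->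
  mu.-integrable `[0, +oo[ (EFin \o f).
Proof.
move=> cf fc; apply: le_integrable (integrable_expRN c) => //.
  by apply/measurable_EFinP/measurable_funTS; exact: continuous_measurable_fun.
move=> t /=; rewrite in_itv/= andbT => t0.
by rewrite lee_fin (le_trans (fc _ t0))// ler_norm.
Qed.

Lemma decay_FTC F f c : continuous f -> (forall t, is_derive t 1 F (f t)) ->
  (forall t, 0 <= t -> `|F t| <= c * expR (- t)) ->
  (forall t, 0 <= t -> `|f t| <= c * expR (- t)) ->
  \int[mu]_(t in `[0, +oo[) f t = - F 0.
Proof.
move=> cf Ff Fc fc.
(* Adding the explicit primitive of [c * expR (- t)] makes the integrand
  nonnegative. *)
pose G t := F t - c * expR (- t).
pose g t := f t + c * expR (- t).
have Gg t : is_derive t 1 G (g t).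
  have Ft := Ff t; have et := is_derive_expRN t.
  rewrite (_ : G = F - cst c * (fun u : R => expR (- u)))//.
  by apply: is_derive_eq; rewrite /g /= /GRing.scale/=; ring.
have cG : continuous G.
  by move=> t; apply/differentiable_continuous/derivable1_diffP;
    apply: ex_derive.
have cg : continuous g.
  move=> t; apply: cvgD; first exact: cf.
  by apply: cvgM; [exact: cvg_cst|exact: continuous_expRN].
have G0 : G t @[t --> +oo] --> 0.
  rewrite (_ : 0 = 0 - c * 0); last by rewrite mulr0 subr0.
  apply: cvgB; last by apply: cvgM; [exact: cvg_cst|exact: cvgr_expR].
  apply: norm_cvg0.
  apply: (@squeeze_cvgr _ _ _ _ (cst 0) (fun t => c * expR (- t))).
  - near=> t; rewrite /= normr_ge0 Fc//.
  - exact: cvg_cst.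
  - by rewrite -[X in _ --> X](mulr0 c); apply: cvgM;
    [exact: cvg_cst|exact: cvgr_expR].
have FTC : \int[mu]_(t in `[0, +oo[) g t = 0 - G 0.
  apply: Rintegral_ge0_continuous_FTC2y.
  - move=> t t0; have := fc _ t0; rewrite ler_norml => /andP[].
    by rewrite -subr_ge0 opprK.
  - exact: continuous_subspaceT.
  - exact: G0.
  - by move=> t _; exact: ex_derive.
  - by apply: cvg_at_right_filter; exact: cG.
  - by move=> t _; rewrite derive1E; exact: derive_val.
move: FTC; rewrite /g /G RintegralD//; last 2 first.
- exact: (decay_integrable cf fc).
- exact: integrable_expRN.
rewrite Rintegral_expRN oppr0 expR0 mulr1 => FTC.
by apply: (addIr c); rewrite FTC; ring.
Unshelve. all: by end_near. Qed.

End exponential_decay.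

(** * Integrals against the kernel [exp (- x cosh t)] and their derivative in [x] *)

Section laplace_cosh.
Context {R : realType}.
Notation mu := (@lebesgue_measure R).
Implicit Types (f : R -> R) (a b c t x nu : R).

Lemma cosh_gt0 t : 0 < cosh t.
Proof. by rewrite divr_gt0// addr_gt0// expR_gt0. Qed.

Lemma coshN t : cosh (- t) = cosh t.
Proof. by rewrite /cosh opprK addrC. Qed.

Lemma continuous_cosh : continuous (@cosh R).
Proof.
move=> t; apply: cvgM; last exact: cvg_cst.
by apply: cvgD; [exact: continuous_expR|exact: continuous_expRN].
Qed.

Lemma cosh_le_expR t : 0 <= t -> cosh t <= expR t.
Proof.
move=> t0; have : expR (- t) <= expR t by rewrite ler_expR; lra.
by rewrite /cosh; lra.
Qed.

(** The two hypotheses together say [|a| <= b]; the difference factors as [(exp b - exp a) (1 - exp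
    (- (a + b))) / 2]. *)
Lemma ler_cosh a b : a <= b -> 0 <= a + b -> cosh a <= cosh b.
Proof.
move=> ab ab0; rewrite -subr_ge0.
have -> : cosh b - cosh a = (expR b - expR a) * (1 - expR (- (a + b))) / 2.
  by rewrite /cosh opprD expRD !expRN; field; rewrite !gt_eqF// expR_gt0.
rewrite divr_ge0// mulr_ge0// subr_ge0 ?ler_expR//.
by rewrite -expR0 ler_expR oppr_le0.
Qed.

Lemma kernel_decay x a : 0 < x -> exists c, forall t, 0 <= t ->
  expR (- (x * cosh t)) * expR (a * t) <= c * expR (- t).
Proof.
(* The point [s] is where [x exp t / 2] has slope [b]. Its tangent there gives
   [x cosh t >= b (1 + t - s)], and slope [|a| + 1] absorbs [a t] with [- t] to spare. *)
move=> x0; pose b := `|a| + 1; pose s := ln (2 * b / x).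
have b0 : 0 < b by rewrite ltr_wpDl.
have es : expR s = 2 * b / x by rewrite lnK// posrE divr_gt0// mulr_gt0.
exists (expR (- (b * (1 - s)))) => t t0; rewrite -!expRD ler_expR.
have : b * (1 + (t - s)) <= x * cosh t.
  apply: (@le_trans _ _ (x * (expR t / 2))); last first.
    by rewrite ler_pM2l// /cosh; have := expR_gt0 (- t); lra.
  rewrite -[t in expR t](subrK s) expRD es.
  rewrite (_ : x * _ = b * expR (t - s)); last by field; rewrite gt_eqF.
  by rewrite ler_pM2l// expR_ge1Dx.
have : a * t <= (b - 1) * t by rewrite ler_wpM2r// /b addrK ler_norm.
lra.
Qed.

(** A growth class on which the kernel integrals converge; multiplication by [cosh] keeps it, with
    [a] replaced by [a + 1], so they can be differentiated in [x]. *)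
Definition expR_dominated a f :=
  continuous f /\ forall t, 0 <= t -> `|f t| <= expR (a * t).

(** A Laplace transform in the variable [cosh t]; at [f = cosh (nu t)] it is [besselK nu x] by
    conversion. *)
Definition coshLaplace f x :=
  \int[mu]_(t in `[0, +oo[) (expR (- (x * cosh t)) * f t).

Lemma continuous_kernel f x : continuous f ->
  continuous (fun t => expR (- (x * cosh t)) * f t).
Proof.
move=> cf t; apply: cvgM; last exact: cf.
apply: (@continuous_comp _ _ _ (fun t => - (x * cosh t)) expR);
  last exact: continuous_expR.
by apply: cvgN; apply: cvgM; [exact: cvg_cst|exact: continuous_cosh].
Qed.

Lemma integrable_kernel a f x : 0 < x -> expR_dominated a f ->
  mu.-integrable `[0, +oo[ (EFin \o (fun t => expR (- (x * cosh t)) * f t)).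
Proof.
move=> x0 [cf fa]; have [c cP] := kernel_decay a x0.
apply: (@decay_integrable _ _ c); first exact: continuous_kernel.
move=> t t0; rewrite normrM ger0_norm ?expR_ge0//.
by rewrite (le_trans _ (cP _ t0))// ler_pM2l ?expR_gt0// fa.
Qed.

Lemma expR_dominated_coshM a f : expR_dominated a f ->
  expR_dominated (a + 1) (fun t => cosh t * f t).
Proof.
move=> [cf fa]; split.
  by move=> t; apply: cvgM; [exact: continuous_cosh|exact: cf].
move=> t t0; rewrite normrM mulrDl mul1r expRD mulrC ler_pM ?fa//.
by rewrite ger0_norm ?(ltW (cosh_gt0 _))// cosh_le_expR.
Qed.

(** Dominated differentiation under the integral. The neighbourhood []x / 2, x + 1[] stays away from
    0, so the kernel at [x / 2] dominates all the others; the exponent [a + 1] pays for the extra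
    factor [cosh t]. *)
Lemma is_derive_coshLaplace a f x : 0 < x -> expR_dominated a f ->
  is_derive x 1 (coshLaplace f) (- coshLaplace (fun t => cosh t * f t) x).
Proof.
move=> x0 fa; pose u := x / 2.
have u0 : 0 < u by rewrite divr_gt0.
have ux : `]u, x + 1[%classic x by rewrite /= in_itv/= /u; apply/andP; split;
  lra.
have [c cP] := kernel_decay (a + 1) u0.
have I0 z : `]u, x + 1[%classic z -> 0 < z.
  by rewrite /= in_itv/= => /andP[uz _]; exact: lt_trans uz.
pose k z t := expR (- (z * cosh t)) * f t.
have dk (z t : R) : is_derive z 1 (k ^~ t) (- (expR (- (z * cosh t)) * (cosh t
  * f t))).
  have dz : is_derive z 1 (- (id * cst (cosh t)) : R -> R) (- cosh t).
    by apply: is_derive_eq; rewrite /= /GRing.scale/=; ring.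
  have := @is_derive1_comp R expR (- (id * cst (cosh t)) : R ->
    R) z _ _ (is_derive_expR _) dz.
  move=> de; rewrite (_ : k ^~ t = (expR \o (- (id * cst (cosh t)) : R ->
    R)) * cst (f t))//.
  by apply: is_derive_eq; rewrite ?fctE /= /GRing.scale/=; ring.
have intk z : `]u, x + 1[%classic z -> mu.-integrable `[0, +oo[ (EFin \o k z).
  by move=> /I0 z0; exact: integrable_kernel fa.
have dk1 (z t : R) : partial1of2 k z t = - (expR (- (z * cosh t)) * (cosh t *
  f t)).
  by rewrite partial1of2E; exact: derive_val.
have c0 : 0 <= c.
  have := cP 0 (lexx _); rewrite oppr0 expR0 mulr1; apply: le_trans.
  by rewrite mulr_ge0 ?expR_ge0.
pose G t := c * expR (- t).
have G0 t : 0 <= G t by rewrite mulr_ge0 ?expR_ge0.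
have kG (z t : R) : `]u, x + 1[%classic z -> `[0%R, +oo[%classic t ->
  `|partial1of2 k z t| <= G t.
  rewrite /= !in_itv/= andbT => /andP[uz _] t0.
  rewrite dk1 normrN normrM ger0_norm ?expR_ge0//.
  rewrite (le_trans _ (cP _ t0))// ler_pM ?expR_ge0//.
    by rewrite ler_expR lerN2 ler_pM2r ?cosh_gt0// ltW.
  by have [_] := expR_dominated_coshM fa; exact.
have dk' (z t : R) : `]u, x + 1[%classic z -> `[0%R, +oo[%classic t ->
  derivable (k ^~ t) z 1.
  by move=> _ _; exact: ex_derive.
have intG := integrable_expRN c.
have dF : derivable (coshLaplace f) x 1.
  by apply: (derivable_under_integral _ ux intk dk' G0 intG kG).
have vF : derive1 (coshLaplace f) x = \int[mu]_(t in `[0, +oo[) partial1of2 k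
  x t.
  by apply: (differentiation_under_integral _ ux intk dk' G0 intG kG).
split; first exact: dF.
rewrite -derive1E vF -[RHS]mulN1r /coshLaplace -RintegralZl//; last first.
  exact: (integrable_kernel x0 (expR_dominated_coshM fa)).
by apply: eq_Rintegral => t _; rewrite dk1 mulN1r.
Qed.

End laplace_cosh.

(** * Positivity, recurrence and derivatives of [besselK], and the Riccati equation *)

Section besselK.
Context {R : realType}.
Notation mu := (@lebesgue_measure R).
Implicit Types (nu x t : R).

Lemma expR_dominated_cosh nu : expR_dominated `|nu| (fun t : R =>
  cosh (nu * t)).
Proof.
split=> [t|t t0].
  apply: (@continuous_comp _ _ _ (fun t => nu * t) (@cosh R)).
    exact: mulrl_continuous.
  exact: continuous_cosh.
rewrite ger0_norm ?(ltW (cosh_gt0 _))//.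
rewrite (@le_trans _ _ (cosh (`|nu| * t)))// ?cosh_le_expR ?mulr_ge0//.
by have [//|_] := ger0P nu; rewrite mulNr coshN.
Qed.

Lemma besselKN nu x : besselK (- nu) x = besselK nu x.
Proof. by apply: eq_Rintegral => t _; rewrite mulNr coshN. Qed.

(** The integrand is nonnegative, and on [[0, 1]] it is at least [exp (- x cosh 1)] because
    [cosh (nu t) >= 1]. *)
Lemma besselK_gt0 nu x : 0 < x -> 0 < besselK nu x.
Proof.
move=> x0; pose k (t : R) := expR (- (x * cosh t)) * cosh (nu * t).
have k0 t : 0 <= k t by rewrite mulr_ge0 ?expR_ge0 ?(ltW (cosh_gt0 _)).
have ik : mu.-integrable `[0, +oo[ (EFin \o k).
  exact: integrable_kernel (expR_dominated_cosh nu).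
have cosh1 : 1 <= cosh (0 : R) by rewrite /cosh oppr0 expR0; lra.
have [c c0 ck] : exists2 c, 0 < c & forall t, 0 <= t <= 1 -> c <= k t.
  exists (expR (- (x * cosh 1))); first exact: expR_gt0.
  move=> t /andP[t0 t1]; rewrite -[leLHS]mulr1 ler_pM ?expR_ge0//.
    by rewrite ler_expR lerN2 ler_pM2l// ler_cosh//; lra.
  rewrite (le_trans cosh1)//; have [nut|nut] := leP 0 (nu * t).
    by rewrite ler_cosh// add0r.
  by rewrite -(coshN (nu * t)) ler_cosh//; lra.
have := @Rintegral_itvB R k (BLeft 0) +oo%O 1 ik;
  rewrite !bnd_simp => /(_ ler01 isT).
move/eqP; rewrite subr_eq => /eqP; rewrite -/(besselK nu x) /besselK => ->.
rewrite ltr_wpDl//; first by apply: Rintegral_ge0.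
apply: (@lt_le_trans _ _ (\int[mu]_(t in `[0, 1]) c)).
  by rewrite Rintegral_cst//= lebesgue_measure_itv/= lte01 oppr0 addr0/= mulr1.
apply: le_Rintegral => //.
- apply: continuous_compact_integrable; first exact: segment_compact.
  by apply: continuous_subspaceT => t; exact: cvg_cst.
- apply: integrableS ik => //.
  by move=> t /=; rewrite !in_itv/= andbT => /andP[].
Qed.

(** The integrands compare pointwise, since [|nu - 1| <= nu] exactly when [nu >= 1 / 2]. *)
Lemma besselK_predle nu x : 0 < x -> 1 / 2 <= nu ->
  besselK (nu - 1) x <= besselK nu x.
Proof.
move=> x0 nu2; apply: le_Rintegral => //.
- exact: integrable_kernel (expR_dominated_cosh _).
- exact: integrable_kernel (expR_dominated_cosh _).
- move=> t /=; rewrite in_itv/= andbT => t0.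
  rewrite ler_pM2l ?expR_gt0// ler_cosh//; nra.
Qed.

(** Product formula: [2 cosh t cosh (nu t) = cosh ((nu + 1) t) + cosh ((nu - 1) t)]. *)
Lemma coshLaplace_coshM nu x : 0 < x ->
  coshLaplace (fun t : R => cosh t * cosh (nu * t)) x =
  (besselK (nu + 1) x + besselK (nu - 1) x) / 2.
Proof.
move=> x0; apply: (@mulfI _ 2);
  rewrite ?pnatr_eq0// [RHS]mulrC divfK ?pnatr_eq0//.
rewrite -RintegralZl//; last first.
  exact: (integrable_kernel x0 (expR_dominated_coshM (expR_dominated_cosh nu))).
rewrite /besselK -RintegralD//; last 2 first.
- exact: integrable_kernel (expR_dominated_cosh _).
- exact: integrable_kernel (expR_dominated_cosh _).
apply: eq_Rintegral => t _; rewrite -mulrDr mulrCA; congr (_ * _).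
rewrite /cosh !mulrDl !mul1r mulN1r !opprD !opprK !expRD.
by field.
Qed.

Lemma is_derive_besselK nu x : 0 < x ->
  is_derive x 1 (besselK nu) (- ((besselK (nu + 1) x + besselK (nu - 1) x) /
    2)).
Proof.
by move=> x0; rewrite -coshLaplace_coshM//;
  exact: is_derive_coshLaplace (expR_dominated_cosh nu).
Qed.

Let sinh t : R := (expR t - expR (- t)) / 2.

Let is_derive_cosh t : is_derive t 1 cosh (sinh t).
Proof.
have et := is_derive_expRN t.
rewrite (_ : cosh = (expR + (fun u : R => expR (- u))) * cst 2^-1)//.
by apply: is_derive_eq; rewrite ?fctE /= /GRing.scale/= /sinh; ring.
Qed.

Let is_derive_sinh t : is_derive t 1 sinh (cosh t).
Proof.
have et := is_derive_expRN t.
rewrite (_ : sinh = (expR - (fun u : R => expR (- u))) * cst 2^-1)//.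
by apply: is_derive_eq; rewrite ?fctE /= /GRing.scale/= /cosh; ring.
Qed.

Let sinh_le_cosh t : `|sinh t| <= cosh t.
Proof.
rewrite ler_norml /sinh /cosh; have := expR_gt0 t; have := expR_gt0 (- t).
by move=> ? ?; apply/andP; split; lra.
Qed.

(** Integration by parts: [exp (- x cosh t) sinh (nu t)] vanishes at 0 and at infinity, so its
    derivative [f] has integral 0. The product [sinh t sinh (nu t)] splits into the orders [nu + 1]
    and [nu - 1]. *)
Lemma besselK_recurrence nu x : 0 < x ->
  nu * besselK nu x = x / 2 * (besselK (nu + 1) x - besselK (nu - 1) x).
Proof.
move=> x0.
have I m := integrable_kernel x0 (expR_dominated_cosh m).
pose e t := expR (- (x * cosh t)).
pose F t := e t * sinh (nu * t).
pose f t := nu * (e t * cosh (nu * t)) -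
  x / 2 * (e t * cosh ((nu + 1) * t) - e t * cosh ((nu - 1) * t)).
have [c cP] := kernel_decay (`|nu| + 1) x0.
(* One factor for both bounds: [F] needs 1, and [f] needs [|nu| + 2 (x / 2)]. *)
pose M := `|nu| + x + 1.
have c0 t : 0 <= t -> 0 <= c * expR (- t).
  by move=> t0; apply: le_trans (cP _ t0); rewrite mulr_ge0 ?expR_ge0.
have e0 t : 0 <= e t by exact: expR_ge0.
have cm m t : 0 <= t -> `|m| <= `|nu| + 1 ->
  e t * cosh (m * t) <= c * expR (- t).
  move=> t0 mnu; apply: le_trans (cP _ t0); rewrite ler_wpM2l//.
  have [_ /(_ _ t0)] := expR_dominated_cosh m;
    rewrite ger0_norm ?(ltW (cosh_gt0 _))//.
  by move=> /le_trans; apply; rewrite ler_expR ler_wpM2r.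
have em m t : 0 <= e t * cosh (m * t) by rewrite mulr_ge0// ltW// cosh_gt0.
have nu0 : `|nu| <= `|nu| + 1 by rewrite lerDl.
have nuD : `|nu + 1| <= `|nu| + 1
  by rewrite (le_trans (ler_normD _ _))// normr1.
have nuB : `|nu - 1| <= `|nu| + 1
  by rewrite (le_trans (ler_normB _ _))// normr1.
have dF t : is_derive t 1 F (f t).
  have de : is_derive t 1 e (- (x * sinh t) * e t).
    have dx : is_derive t 1 (- (cst x * cosh)) (- (x * sinh t)).
      by have := is_derive_cosh t => dc; apply: is_derive_eq;
        rewrite ?fctE /= /GRing.scale/=; ring.
    have := @is_derive1_comp R expR (- (cst x * cosh)) t _ _ (is_derive_expR
      _) dx.
    by move=> de; rewrite mulrC; exact: de.
  have ds : is_derive t 1 (sinh \o (fun u => nu * u)) (cosh (nu * t) * nu).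
    apply: is_derive1_comp; first exact: is_derive_sinh.
    have di : is_derive t 1 (cst nu * id : R -> R) nu.
      by apply: is_derive_eq; rewrite /= /GRing.scale/=; ring.
    exact: di.
  rewrite (_ : F = e * (sinh \o (fun u => nu * u)))//.
  apply: is_derive_eq; rewrite ?fctE /= /GRing.scale/= /f /sinh /cosh.
  rewrite !mulrDl !mul1r !opprD mulN1r opprK !expRD.
  by field.
have cf : continuous f.
  have ce m : continuous (fun t => e t * cosh (m * t)).
    by apply: continuous_kernel; have [] := expR_dominated_cosh m.
  move=> t; apply: cvgB; first by apply: cvgM; [exact: cvg_cst|exact: ce].
  by apply: cvgM; [exact: cvg_cst|apply: cvgB; exact: ce].
have FM t : 0 <= t -> `|F t| <= M * c * expR (- t).
  move=> t0; rewrite -mulrA normrM ger0_norm//.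
  apply: (@le_trans _ _ (1 * (c * expR (- t)))).
    rewrite mul1r; apply: le_trans (cm nu t t0 nu0).
    by rewrite ler_wpM2l.
  by rewrite ler_wpM2r ?c0// /M lerDr addr_ge0// ltW.
have fM t : 0 <= t -> `|f t| <= M * c * expR (- t).
  move=> t0; rewrite -mulrA (le_trans (ler_normB _ _))// normrM [`|x / 2 *
    _|]normrM.
  have x2 : `|x / 2| = x / 2 by rewrite ger0_norm// divr_ge0// ltW.
  have h1 : `|nu| * `|e t * cosh (nu * t)| <= `|nu| * (c * expR (- t)).
    by rewrite ler_wpM2l// ger0_norm// cm.
  have h2 : `|e t * cosh ((nu + 1) * t) - e t * cosh ((nu - 1) * t)| <= c *
    expR (- t) + c * expR (- t).
    by rewrite (le_trans (ler_normB _ _))// lerD// ger0_norm// cm.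
  have h3 := c0 _ t0.
  rewrite x2 /M; apply: (le_trans (lerD h1 (ler_wpM2l _ h2)));
    first by rewrite divr_ge0// ltW.
  lra.
have := decay_FTC cf dF FM fM.
rewrite /F mulr0 /sinh oppr0 subrr mul0r mulr0 oppr0 /f.
have ZI d (g : R -> R) : mu.-integrable `[0, +oo[ (EFin \o g) ->
    mu.-integrable `[0, +oo[ (EFin \o (fun t => d * g t)).
  move=> ig; rewrite (_ : _ \o _ = fun t => d%:E * (EFin \o g) t)%E//.
  exact: integrableZl.
have BI (g h : R -> R) : mu.-integrable `[0, +oo[ (EFin \o g) ->
    mu.-integrable `[0, +oo[ (EFin \o h) ->
    mu.-integrable `[0, +oo[ (EFin \o (fun t => g t - h t)).
  move=> ig ih; rewrite (_ : _ \o _ = (EFin \o g) \- (EFin \o h))%E//.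
  exact: integrableB.
have ID := BI _ _ (I (nu + 1)) (I (nu - 1)).
rewrite RintegralB//; [|exact: (ZI nu _ (I nu))|exact: (ZI _ _ ID)].
rewrite !RintegralZl// RintegralB//.
by move/eqP; rewrite subr_eq0 => /eqP.
Qed.

(** The quotient rule brings in the orders [nu + 1] and [nu - 2]; the recurrences at [nu] and
    [nu - 1] eliminate them in favour of [nu] and [nu - 1]. *)
Lemma is_derive_Kratio nu x : 0 < x ->
  is_derive x 1 (Kratio nu)
    (Kratio nu x ^+ 2 + 2 * (nu - 1 / 2) * Kratio nu x / x - 1).
Proof.
move=> x0; have Kn0 : besselK nu x != 0 by rewrite gt_eqF// besselK_gt0.
have d1 := is_derive_besselK (nu - 1) x0; have d0 := is_derive_besselK nu x0.
have di := is_deriveV Kn0 d0.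
suff : is_derive x 1 (besselK (nu - 1) * (fun y => (besselK nu y)^-1))
  (Kratio nu x ^+ 2 + 2 * (nu - 1 / 2) * Kratio nu x / x - 1) by [].
apply: is_derive_eq; rewrite ?fctE /= /GRing.scale/= /Kratio.
have := besselK_recurrence nu x0; have := besselK_recurrence (nu - 1) x0.
rewrite subrK => r1 r0.
have -> : besselK (nu + 1) x = 2 * nu / x * besselK nu x + besselK (nu - 1) x.
  by rewrite -(mulrA (2 * nu)) (mulrC x^-1) mulrA -(mulrA 2) r0; field;
    rewrite gt_eqF.
have -> : besselK (nu - 1 - 1) x = besselK nu x - 2 * (nu - 1) / x * besselK
  (nu - 1) x.
  by rewrite -(mulrA (2 * _)) (mulrC x^-1) mulrA -(mulrA 2) r1; field;
    rewrite gt_eqF.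
by field; rewrite Kn0 gt_eqF.
Qed.

Lemma Kratio_gt0 nu x : 0 < x -> 0 < Kratio nu x.
Proof. by move=> x0; rewrite divr_gt0// besselK_gt0. Qed.

Lemma Kratio_le1 nu x : 0 < x -> 1 / 2 <= nu -> Kratio nu x <= 1.
Proof. by move=> x0 nu2; rewrite ler_pdivrMr ?besselK_gt0// mul1r
  besselK_predle. Qed.

Lemma Kratio_half x : 0 < x -> Kratio (1 / 2) x = 1.
Proof.
move=> x0; rewrite /Kratio (_ : 1 / 2 - 1 = - (1 / 2)); last by lra.
by rewrite besselKN divff// gt_eqF// besselK_gt0.
Qed.

End besselK.

(** * Comparison with [Dbound] through the sign of a quadratic *)

Section Dbound.
Context {R : realType}.
Implicit Types alpha nu x h : R.

(** The roots of the quadratic are [Dbound alpha nu x] and the negative number [- p / x]. For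
    [h > 0] the second factor is positive, so the quadratic has the sign of
    [h - Dbound alpha nu x]. *)
Lemma Dbound_factor alpha nu x h : 0 < x -> exists2 p, 0 < p &
  x * h ^+ 2 + 2 * phi alpha nu x * h - x =
  (h - Dbound alpha nu x) * (x * h + p).
Proof.
move=> x0; rewrite /Dbound; set f := phi _ _ _; set s := Num.sqrt _.
have s2 : s ^+ 2 = f ^+ 2 + x ^+ 2 by rewrite sqr_sqrtr// addr_ge0 ?sqr_ge0.
have x2 : 0 < x ^+ 2 by rewrite exprn_gt0.
have fs : `|f| < s.
  by rewrite -sqrtr_sqr ltr_sqrt ?ltrDl// ltr_wpDl ?sqr_ge0.
have p0 : 0 < f + s by move: fs; rewrite ltr_norml => /andP[]; lra.
exists (f + s) => //; have pn0 : f + s != 0 by rewrite gt_eqF.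
(* Rationalising the denominator gives the usual formula for the positive root. *)
have -> : x / (f + s) = (s - f) / x.
  apply: (@mulIf _ ((f + s) * x)); first by rewrite mulf_neq0// gt_eqF.
  have -> : x / (f + s) * ((f + s) * x) = x ^+ 2 by field.
  have -> : (s - f) / x * ((f + s) * x) = s ^+ 2 - f ^+ 2.
    by field; rewrite gt_eqF.
  by rewrite s2; ring.
have -> : (h - (s - f) / x) * (x * h + (f + s)) =
  x * h ^+ 2 + 2 * f * h - (s ^+ 2 - f ^+ 2) / x.
  by field; rewrite gt_eqF.
by rewrite s2; field; rewrite gt_eqF.
Qed.

Lemma Dbound_lt alpha nu x h : 0 < x -> 0 < h ->
  (Dbound alpha nu x < h) = (x < x * h ^+ 2 + 2 * phi alpha nu x * h).
Proof.
move=> x0 h0; have [p p0 E] := Dbound_factor alpha nu h x0.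
by rewrite -subr_gt0 -[RHS]subr_gt0 E pmulr_lgt0// addr_gt0// mulr_gt0.
Qed.

Lemma lt_Dbound alpha nu x h : 0 < x -> 0 < h ->
  (h < Dbound alpha nu x) = (x * h ^+ 2 + 2 * phi alpha nu x * h < x).
Proof.
move=> x0 h0; have [p p0 E] := Dbound_factor alpha nu h x0.
by rewrite -subr_lt0 -[RHS]subr_lt0 E pmulr_llt0// addr_gt0// mulr_gt0.
Qed.

(** At [h = 1] the quadratic reduces to [2 phi], and at [nu = 1 / 2] this vanishes only if
    [tau = - alpha / 2] does. *)
Lemma Dbound_half_eq1 alpha x : 0 < x ->
  (Dbound alpha (1 / 2) x == 1) = (alpha == 0).
Proof.
move=> x0; have [p p0] := Dbound_factor alpha (1 / 2) 1 x0.
rewrite expr1n !mulr1 addrAC subrr add0r => E.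
have xp0 : x + p != 0 by rewrite gt_eqF// addr_gt0.
rewrite eq_sym -subr_eq0 -(mulIr_eq0 _ (mulIf xp0)) -E.
rewrite mulf_eq0 pnatr_eq0/= /phi subrr sub0r oppr_eq0.
rewrite (_ : tau alpha (1 / 2) = - (alpha / 2)); last by rewrite /tau; field.
have r0 : 0 < Num.sqrt ((- (alpha / 2)) ^+ 2 + x ^+ 2).
  by rewrite sqrtr_gt0 ltr_wpDl ?sqr_ge0// exprn_gt0.
by rewrite mulNr oppr_eq0 !mulf_eq0 !invr_eq0 mulf_eq0 (gt_eqF r0) pnatr_eq0/=
  !orbF.
Qed.

Lemma Dbound_lt_Kratio nu x : 1 / 2 < nu -> 0 < x ->
  Dbound (2 * nu - 1) nu x < Kratio nu x.
Proof.
move=> nu2 x0; rewrite Dbound_lt ?Kratio_gt0//.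
have -> : phi (2 * nu - 1) nu x = nu - 1 / 2.
  rewrite /phi (_ : tau _ _ = 0) ?mul0r ?subr0//.
  by rewrite /tau; field.
apply: (@riccati_lower _ (Kratio nu) (nu - 1 / 2)) => //; first by lra.
- by move=> y y0; exact: is_derive_Kratio.
- by move=> y y0; exact: Kratio_gt0.
Qed.

Lemma Kratio_lt_Dbound nu x : 1 / 2 < nu -> 0 < x ->
  Kratio nu x < Dbound 0 nu x.
Proof.
move=> nu2 x0; rewrite lt_Dbound ?Kratio_gt0//.
have tauE : tau 0 nu = nu - 1 / 2 by rewrite /tau add0r.
set l := nu - 1 / 2 in tauE *; have l0 : 0 < l by rewrite /l; lra.
have s0 : 0 < Num.sqrt (l ^+ 2 + x ^+ 2).
  by rewrite sqrtr_gt0 ltr_pwDl ?sqr_ge0// exprn_gt0.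
have -> : 2 * phi 0 nu x = 2 * l - l / Num.sqrt (l ^+ 2 + x ^+ 2).
  by rewrite /phi tauE -/l; field; rewrite gt_eqF.
apply: (@riccati_upper _ (Kratio nu) l) => //.
- by move=> y y0; exact: is_derive_Kratio.
- by move=> y y0; rewrite Kratio_gt0// Kratio_le1// ltW.
Qed.

End Dbound.

(** * The bounds, their equality cases and the exclusion of other [alpha] *)

Theorem theorem9 (R : realType) :
  (forall nu x : R, 1 / 2 <= nu -> 0 < x ->
     [/\ Dbound (2 * nu - 1) nu x <= Kratio nu x,
         Kratio nu x <= Dbound 0 nu x,
         Dbound (2 * nu - 1) nu x = Kratio nu x <-> nu = 1 / 2
       & Kratio nu x = Dbound 0 nu x <-> nu = 1 / 2]) /\
  ~ (exists alpha : R, alpha <> 0 /\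
       (((forall nu x : R, 1 / 2 <= nu -> 0 < x ->
            Dbound (2 * nu - 1) nu x <= Dbound alpha nu x /\
            Dbound alpha nu x <= Kratio nu x) /\
         (exists nu x : R, 1 / 2 <= nu /\ 0 < x /\
            Dbound (2 * nu - 1) nu x < Dbound alpha nu x))
        \/
        ((forall nu x : R, 1 / 2 <= nu -> 0 < x ->
            Kratio nu x <= Dbound alpha nu x /\
            Dbound alpha nu x <= Dbound 0 nu x) /\
         (exists nu x : R, 1 / 2 <= nu /\ 0 < x /\
            Dbound alpha nu x < Dbound 0 nu x)))).
Proof.
have D0 x : 0 < x -> Dbound 0 (1 / 2) x = 1 :> R.
  by move=> x0; apply/eqP; rewrite Dbound_half_eq1.
(* At [nu = 1 / 2] the parameters [2 nu - 1] and 0 coincide, so the lower and upper bounds are the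
   same. *)
have half0 : 2 * (1 / 2) - 1 = 0 :> R by field.
split.
  move=> nu x; rewrite le_eqVlt => /predU1P[<- x0|nu2 x0].
    by rewrite half0 D0// Kratio_half.
  have lo := Dbound_lt_Kratio nu2 x0; have up := Kratio_lt_Dbound nu2 x0.
  split; rewrite ?ltW//; split=> e.
  - by move: lo; rewrite e ltxx.
  - by move: nu2; rewrite e ltxx.
  - by move: up; rewrite e ltxx.
  - by move: nu2; rewrite e ltxx.
case=> alpha [/eqP /negP alpha0 best]; apply: alpha0.
rewrite -(Dbound_half_eq1 alpha ltr01).
(* At [nu = 1 / 2] and [x = 1] either alternative squeezes [Dbound alpha] between 1 and 1, which
   forces [alpha = 0]. *)
case: best => -[/(_ _ _ (lexx (1 / 2)) ltr01) + _];
  rewrite ?half0 D0// Kratio_half//.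
  by move=> -[? ?]; apply/eqP/le_anti/andP.
by move=> -[? ?]; apply/eqP/le_anti/andP.
Qed.
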